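(* Let $\mathcal D$ be the adjacency matrix of a Dynkin diagram of type $A_n$ ($n\ge 2$), $D_n$ ($n\ge 4$), $E_6$, $E_7$, $E_8$, or of a diagram of type $L_n$ ($n\ge 2$), and let $h$ be the Coxeter number of the diagram. Then for every integer $k\ge 0$, $f_k(\mathcal D)=0$ if and only if $k=rh-1$ for some integer $r\ge 1$.
   Context: The polynomials $f_k(x)$ (rescaled Chebyshev polynomials of the second kind) are defined by $f_{-1}(x)=0$, $f_0(x)=1$, $f_1(x)=x$, $f_k(x)=xf_{k-1}(x)-f_{k-2}(x)$; they are evaluated on square matrices with $f_0(X)=I$. The adjacency matrix of a graph on vertices $1,\dots,n$ has $(i,j)$ entry equal to the number of edges between $i$ and $j$ (a loop at $i$ contributes $1$ to the $(i,i)$ entry). The diagrams: $A_n$ is the path $1-2-\cdots-n$. $L_n$ is the path $1-2-\cdots-n$ with one loop at vertex $1$. $D_n$ has edges $1-3$, $2-3$, $3-4,\dots,(n-1)-n$. $E_6$ is the path $1-2-3-4-5$ together with an edge $3-6$; $E_7$ is the path $1-2-\cdots-6$ together with an edge $3-7$; $E_8$ is the path $1-2-\cdots-7$ together with an edge $3-8$. Coxeter numbers: $h=n+1$ for $A_n$; $h=2n-2$ for $D_n$; $h=12,18,30$ for $E_6,E_7,E_8$; and $h=2n+1$ for $L_n$. *)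

(* Defs.v *)
From mathcomp Require Import all_boot all_order all_algebra.

Set Implicit Arguments.
Unset Strict Implicit.
Unset Printing Implicit Defensive.

Import GRing.Theory.
Local Open Scope ring_scope.

(* The recursion extends to f_(-1) = 0, which is not needed for k : nat. *)
Fixpoint f (k : nat) : {poly int} :=
  match k with
  | 0 => 1
  | k'.+1 => match k' with
             | 0 => 'X
             | k''.+1 => 'X * f k' - f k''
             end
  end.

Inductive diagram : Type :=
  | TypeA of nat
  | TypeD of nat
  | TypeE6
  | TypeE7
  | TypeE8
  | TypeL of nat.

Definition admissible (d : diagram) : bool :=
  match d with
  | TypeA n => 2 <= n
  | TypeD n => 4 <= n
  | TypeE6 | TypeE7 | TypeE8 => true
  | TypeL n => 2 <= n
  end%N.

Definition nvertices (d : diagram) : nat :=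
  match d with
  | TypeA n | TypeD n | TypeL n => n
  | TypeE6 => 6
  | TypeE7 => 7
  | TypeE8 => 8
  end.

(* The edges of the path m - (m+1) - ... - n. *)
Definition path_edges (m n : nat) : seq (nat * nat) :=
  [seq (i, i.+1) | i <- iota m (n - m)%N].

(* Vertices are numbered from 1; each edge is listed once, in one of its two
   orientations, and (i, i) is a loop. *)
Definition edges (d : diagram) : seq (nat * nat) :=
  match d with
  | TypeA n => path_edges 1 n
  | TypeD n => [:: (1, 3), (2, 3) & path_edges 3 n]
  | TypeE6 => (3, 6) :: path_edges 1 5
  | TypeE7 => (3, 7) :: path_edges 1 6
  | TypeE8 => (3, 8) :: path_edges 1 7
  | TypeL n => (1, 1) :: path_edges 1 n
  end%N.

Definition coxeter_number (d : diagram) : nat :=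
  match d with
  | TypeA n => n + 1
  | TypeD n => 2 * n - 2
  | TypeE6 => 12
  | TypeE7 => 18
  | TypeE8 => 30
  | TypeL n => 2 * n + 1
  end%N.

(* The number of edges between i and j; a loop counts once. *)
Definition nedges (d : diagram) (i j : nat) : nat :=
  count [pred e : nat * nat | (e == (i, j)) || (e == (j, i))] (edges d).

(* The dimension is written n.-1.+1, equal to n = nvertices d for every
   admissible d, because horner_mx requires a successor.  The ordinal i
   stands for the vertex i.+1. *)
Definition adjacency (d : diagram) : 'M[int]_((nvertices d).-1.+1) :=
  \matrix_(i, j) (nedges d i.+1 j.+1)%:Z.

Lemma nvertices_pred (d : diagram) :
  admissible d -> (nvertices d).-1.+1 = nvertices d.
Proof. by case: d => // -[]. Qed.

(* Main.v *)
Require Import Defs.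
From mathcomp Require Import all_boot all_order all_algebra.
From mathcomp Require Import zify ring.

(**
  Write U_k for f_k(D). If U_(h-1) = 0, the recursion gives
  U_(h+j) = U_h U_j, and the identity
  f_(k+1)^2 + f_k^2 - x f_k f_(k+1) = 1 gives U_h^2 = 1. So the zeros of
  k |-> U_k are periodic with period h, and it is enough to show that h - 1 is
  the first one.

  For A_n and L_n the vector e U_k, where e is the vertex at the unlooped end
  of the path, walks along the path one vertex at a time; for L_n the loop
  reflects it, so that it leaves the diagram exactly at k = h - 1. The vector e
  is cyclic for D, hence U_(h-1) = 0. In type D_n the same walk from the vertex
  n is reflected at the fork, and generates the vectors that are symmetric in
  the vertices 1 and 2. The antisymmetric line is killed by D, hence by U_k for
  odd k, in particular for k = h - 1. The three exceptional diagrams are settled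
  by computing the rows of U_k.
*)

Set Implicit Arguments.
Unset Strict Implicit.
Unset Printing Implicit Defensive.

Import GRing.Theory.
Local Open Scope ring_scope.

(** * Identities for [f] at a general matrix *)

Lemma fSS k : f k.+2 = 'X * f k.+1 - f k.
Proof. by []. Qed.

(** The quadratic form a^2 + b^2 - x a b is invariant under the recursion step (a, b) -> (b, x b -
    a). *)
Lemma f_pell k : f k.+1 ^+ 2 + f k ^+ 2 - 'X * f k * f k.+1 = 1.
Proof.
elim: k => [|k IHk]; first by rewrite /=; ring.
by rewrite -[RHS]IHk fSS; ring.
Qed.

Lemma horner_mx_fSS n (A : 'M[int]_n.+1) k :
  horner_mx A (f k.+2) = A * horner_mx A (f k.+1) - horner_mx A (f k).
Proof. by rewrite fSS rmorphB rmorphM /= horner_mx_X. Qed.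

Lemma mul_horner_mx_f n (A : 'M[int]_n.+1) k :
  A * horner_mx A (f k) = horner_mx A (f k) * A.
Proof.
have := congr1 (horner_mx A) (mulrC 'X (f k)).
by rewrite !rmorphM /= horner_mx_X.
Qed.

(** In [j] both sides obey the same three-term recursion; [f m] vanishing at [A] plays the role of
    f_(-1) = 0 and makes them agree at [j] = 0 and 1. *)
Lemma horner_mx_f_mulr n (A : 'M[int]_n.+1) m j :
    horner_mx A (f m) = 0 ->
  horner_mx A (f (m.+1 + j)%N) = horner_mx A (f m.+1) * horner_mx A (f j).
Proof.
move=> Um0.
suff: horner_mx A (f (m.+1 + j)%N) = horner_mx A (f m.+1) * horner_mx A (f j)
   /\ horner_mx A (f (m.+1 + j.+1)%N) =
      horner_mx A (f m.+1) * horner_mx A (f j.+1) by case.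
elim: j => [|j [IH0 IH1]].
  rewrite addn0 rmorph1 mulr1 addn1 horner_mx_fSS Um0 subr0; split=> //.
  by rewrite horner_mx_X mul_horner_mx_f.
split=> //; rewrite !addnS in IH1 *.
rewrite horner_mx_fSS (horner_mx_fSS A j) IH0 IH1.
by rewrite mulrBr !mulrA mul_horner_mx_f.
Qed.

Lemma horner_mx_f_eq0 n (A : 'M[int]_n.+1) h k :
    (0 < h)%N -> horner_mx A (f h.-1) = 0 ->
    (forall i, (i < h.-1)%N -> horner_mx A (f i) <> 0) ->
  horner_mx A (f k) = 0 <-> exists r : nat, (1 <= r)%N /\ k = (r * h - 1)%N.
Proof.
case: h => // m _ /= Um0 Ult; have [j] := ubnP k; elim: j => // j IHj in k *.
move=> ltkj; have [ltkm|ltmk|->] := ltngtP k m; last first.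
- by split=> // _; exists 1%N; split=> //; lia.
- have [i def_k] : exists i, k = (m.+1 + i)%N by exists (k - m.+1)%N; lia.
  (* The matrix of [f m.+1] is its own inverse, so multiplying by it neither creates nor destroys
     zeros. This moves a zero beyond [m] down by one period. *)
  have Uh2 : horner_mx A (f m.+1) * horner_mx A (f m.+1) = 1.
    have := congr1 (horner_mx A) (f_pell m).
    rewrite rmorphB rmorphD !rmorphXn !rmorphM /= Um0 mulr0 mul0r subr0.
    by rewrite expr0n addr0 rmorph1 expr2.
  have -> : horner_mx A (f k) = 0 <-> horner_mx A (f i) = 0.
    rewrite def_k horner_mx_f_mulr //; split=> [UU0|->]; last by rewrite mulr0.
    by rewrite -[LHS]mul1r -Uh2 -mulrA UU0 mulr0.
  rewrite IHj; last by lia.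
  split=> -[r [r_gt0 def_r]]; first by exists r.+1; split=> //; nia.
  (* [r] = 1 would mean [k] = [m], but here [m < k]. *)
  have [r1|r_gt1] : r = 1%N \/ (1 < r)%N by lia.
    by rewrite r1 in def_r; lia.
  by exists r.-1; split; nia.
- split=> [/(Ult _ ltkm)//|[r [r_gt0 def_r]]]; nia.
Qed.

(** Polynomials in [A] commute. Hence what kills a generator of a cyclic module kills every vector
    that the walk reaches. *)
Lemma mulmx_f_comm n (A : 'M[int]_n.+1) (u : 'rV[int]_n.+1) i j :
  u *m horner_mx A (f i) = 0 ->
  u *m horner_mx A (f j) *m horner_mx A (f i) = 0.
Proof.
move=> ui0; rewrite -mulmxA.
have -> : horner_mx A (f j) *m horner_mx A (f i) =
          horner_mx A (f i) *m horner_mx A (f j).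
  by rewrite !mulmxE -!rmorphM mulrC.
by rewrite mulmxA ui0 mul0mx.
Qed.

(* The index of [w] is shifted by one with respect to that of [f], so that
   [w 0 = 0] plays the role of f_(-1) = 0. *)
Lemma mulmx_f_rec n (A : 'M[int]_n.+1) (w : nat -> 'rV[int]_n.+1) K :
    w 0 = 0 -> (forall k, (k < K)%N -> w k.+2 = w k.+1 *m A - w k) ->
  forall k, (k <= K)%N -> w 1%N *m horner_mx A (f k) = w k.+1.
Proof.
move=> w0 wSS k.
suff: ((k <= K)%N -> w 1%N *m horner_mx A (f k) = w k.+1)
   /\ ((k < K)%N -> w 1%N *m horner_mx A (f k.+1) = w k.+2) by case.
elim: k => [|k [IH0 IH1]]; split=> // ltkK.
- by rewrite rmorph1 mulmx1.
- by rewrite wSS // w0 subr0 horner_mx_X.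
rewrite horner_mx_fSS mulmxBr IH0; last by lia.
rewrite (wSS _ ltkK) -IH1 1?ltnW // -[in RHS]mulmxA; congr (_ *m _ - _).
exact: mul_horner_mx_f.
Qed.

(** * Vertex vectors and the action of the adjacency matrix *)

Definition vtx n (j : nat) : 'rV[int]_n.+1 := \row_i ((i.+1 == j) : nat)%:Z.

(** Thanks to this convention a walk that steps off the end of the path becomes zero, and the
    neighbour formulas need no separate case at an unlooped end. *)
Lemma vtx_out n j : (j == 0%N) || (n.+1 < j)%N -> vtx n j = 0.
Proof. by move=> out; apply/rowP=> i; rewrite !mxE; have := ltn_ord i; lia. Qed.

Lemma vtx_neq0 n j : (0 < j <= n.+1)%N -> vtx n j <> 0.
Proof.
move=> jn /rowP /(_ (inord j.-1)); rewrite !mxE inordK; lia.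
Qed.

Lemma vtx_mul n (M : 'M[int]_n.+1) (i : 'I_n.+1) : vtx n i.+1 *m M = row i M.
Proof.
rewrite rowE; congr (_ *m _); apply/rowP=> j.
rewrite !mxE eqSS -[(j == i :> nat)]/(j == i).
by case: (j == i).
Qed.

Lemma vtx_mul_eq0 n (M : 'M[int]_n.+1) :
  (forall j, (0 < j <= n.+1)%N -> vtx n j *m M = 0) -> M = 0.
Proof. by move=> M0; apply/row_matrixP=> i; rewrite row0 -vtx_mul M0 //=. Qed.

Lemma vtx_adjacency d j : (0 < j <= (nvertices d).-1.+1)%N ->
  vtx (nvertices d).-1 j *m adjacency d = \row_i (nedges d j i.+1)%:Z.
Proof.
move=> jn; have ltj : (j.-1 < (nvertices d).-1.+1)%N by lia.
have -> : j = (Ordinal ltj).+1 by rewrite /=; lia.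
by rewrite vtx_mul; apply/rowP=> i; rewrite !mxE.
Qed.

(** This makes every entry of an adjacency matrix a boolean arithmetic expression within reach of
    [lia]. *)
Lemma count_path_edges m n i j :
  count [pred e : nat * nat | (e == (i, j)) || (e == (j, i))] (path_edges m n) =
  ((m <= i) && (j == i.+1) && (j <= n) + (m <= j) && (i == j.+1) && (i <= n))%N.
Proof.
rewrite /path_edges count_map.
rewrite (eq_count (a2 := predU (fun x => (x == i) && (j == i.+1))
   (fun x => (x == j) && (i == j.+1)))); last first.
  by move=> x /=; rewrite !xpair_eqE; lia.
(* The two orientations exclude each other. *)
rewrite -[LHS]addn0 -[X in (_ + X)%N](count_pred0 (iota m (n - m))).
rewrite (eq_count (a1 := pred0) (a2 := predI (fun x => (x == i) && (j == i.+1))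
   (fun x => (x == j) && (i == j.+1)))); last by move=> x /=; lia.
rewrite count_predUI.
have count_and a b c : count (fun x => (x == a) && b) (iota m c) =
    (b && (m <= a < m + c) : nat)%N.
  case: b; last first.
    by rewrite (eq_count (a2 := pred0)) ?count_pred0 // => x; rewrite andbF.
  rewrite (eq_count (a2 := pred1 a)) => [|x /=]; last by rewrite andbT.
  by rewrite count_uniq_mem ?iota_uniq // mem_iota.
by rewrite !count_and; lia.
Qed.

Lemma vtx_adjacencyA n j : (0 < j <= n)%N ->
  vtx n.-1 j *m adjacency (TypeA n) = vtx n.-1 j.-1 + vtx n.-1 j.+1.
Proof.
move=> jn; rewrite (@vtx_adjacency (TypeA n)) /=; last by lia.
apply/rowP=> i; rewrite !mxE /nedges /= count_path_edges.
by have := ltn_ord i; lia.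
Qed.

Lemma vtx_adjacencyL n j : (1 < j <= n)%N ->
  vtx n.-1 j *m adjacency (TypeL n) = vtx n.-1 j.-1 + vtx n.-1 j.+1.
Proof.
move=> jn; rewrite (@vtx_adjacency (TypeL n)) /=; last by lia.
apply/rowP=> i; rewrite !mxE /nedges /= count_path_edges !xpair_eqE.
by have := ltn_ord i; lia.
Qed.

Lemma vtx_adjacencyL1 n : (0 < n)%N ->
  vtx n.-1 1 *m adjacency (TypeL n) = vtx n.-1 1 + vtx n.-1 2.
Proof.
move=> jn; rewrite (@vtx_adjacency (TypeL n)) /=; last by lia.
apply/rowP=> i; rewrite !mxE /nedges /= count_path_edges !xpair_eqE.
by have := ltn_ord i; lia.
Qed.

Lemma vtx_adjacencyD n j : (3 < j <= n)%N ->
  vtx n.-1 j *m adjacency (TypeD n) = vtx n.-1 j.-1 + vtx n.-1 j.+1.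
Proof.
move=> jn; rewrite (@vtx_adjacency (TypeD n)) /=; last by lia.
apply/rowP=> i; rewrite !mxE /nedges /= count_path_edges !xpair_eqE.
by have := ltn_ord i; lia.
Qed.

Lemma vtx_adjacencyD1 n j : (0 < j <= 2)%N -> (3 <= n)%N ->
  vtx n.-1 j *m adjacency (TypeD n) = vtx n.-1 3.
Proof.
move=> jn n3; rewrite (@vtx_adjacency (TypeD n)) /=; last by lia.
apply/rowP=> i; rewrite !mxE /nedges /= count_path_edges !xpair_eqE.
by have := ltn_ord i; lia.
Qed.

Lemma vtx_adjacencyD3 n : (3 <= n)%N ->
  vtx n.-1 3 *m adjacency (TypeD n) = vtx n.-1 1 + vtx n.-1 2 + vtx n.-1 4.
Proof.
move=> n3; rewrite (@vtx_adjacency (TypeD n)) /=; last by lia.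
apply/rowP=> i; rewrite !mxE /nedges /= count_path_edges !xpair_eqE.
by have := ltn_ord i; lia.
Qed.

(** * The infinite families *)

Lemma horner_mx_fA n : (2 <= n)%N ->
  let A := adjacency (TypeA n) in
  horner_mx A (f n) = 0 /\ forall i, (i < n)%N -> horner_mx A (f i) <> 0.
Proof.
move=> n_ge2 A.
have vtxU k : (k <= n)%N -> vtx n.-1 1 *m horner_mx A (f k) = vtx n.-1 k.+1.
  apply: (mulmx_f_rec (w := vtx n.-1)) => [|{}k ltkn].
    by rewrite vtx_out.
  by rewrite vtx_adjacencyA /= 1?addrC ?addKr //; lia.
split=> [|i ltin Ui0]; last first.
  have := vtxU i (ltnW ltin); rewrite Ui0 mulmx0 => /esym.
  by apply: vtx_neq0; rewrite /=; lia.
(* The walk from vertex 1 visits every vertex before it leaves the path at step [n]. *)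
apply: vtx_mul_eq0 => j /= jn; have -> : j = j.-1.+1 by lia.
rewrite -vtxU; last by lia.
by apply: mulmx_f_comm; rewrite vtxU // vtx_out //=; lia.
Qed.

Lemma horner_mx_fL n : (2 <= n)%N ->
  let A := adjacency (TypeL n) in
  horner_mx A (f (2 * n)%N) = 0 /\
  forall i, (i < 2 * n)%N -> horner_mx A (f i) <> 0.
Proof.
move=> n_ge2 A.
(* The walk starts at vertex [n] for [k] = 1, is at vertex 1 for both [k] = [n] and [k] = [n.+1]
   because of the loop, climbs back to [n] at [k] = 2n and is zero at [k] = 2n + 1. *)
pose w k := vtx n.-1 (if (k <= n)%N then n.+1 - k else k - n)%N.
have wlo k : (k <= n)%N -> w k = vtx n.-1 (n.+1 - k)%N by rewrite /w => ->.
have whi k : (n < k)%N -> w k = vtx n.-1 (k - n)%N.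
  by rewrite /w ltnNge => /negbTE ->.
have wU k : (k <= 2 * n)%N -> w 1%N *m horner_mx A (f k) = w k.+1.
  apply: (mulmx_f_rec (w := w)) => [|{}k ltkn].
    by rewrite wlo // vtx_out //=; lia.
  have [lekn|[eqkn|[->|ltnk]]] :
    ((k.+2 <= n) \/ (k.+1 = n) \/ (k = n) \/ (n < k))%N by lia.
  - rewrite !wlo; try lia.
    have [-> -> ->] : [/\ n.+1 - k = (n - k).+1, n.+1 - k.+1 = n - k
                       & n.+1 - k.+2 = (n - k).-1]%N by split; lia.
    by rewrite vtx_adjacencyL ?addrK //; lia.
  - rewrite (whi k.+2) ?wlo; try lia.
    have [-> -> ->] : [/\ n.+1 - k = 2, n.+1 - k.+1 = 1 & k.+2 - n = 1]%N.
      by split; lia.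
    by rewrite vtx_adjacencyL1 ?addrK //; lia.
  - rewrite (whi n.+2) ?(whi n.+1) ?wlo //; try lia.
    have [-> ->] : (n.+2 - n = 2 /\ n.+1 - n = 1)%N by lia.
    by rewrite vtx_adjacencyL1 1?addrC ?addKr //; lia.
  rewrite !whi; try lia.
  have [-> ->] : ((k - n = (k.+1 - n).-1) /\ (k.+2 - n = (k.+1 - n).+1))%N.
    by split; lia.
  by rewrite vtx_adjacencyL 1?addrC ?addKr //; lia.
split=> [|i ltin Ui0]; last first.
  have := wU i (ltnW ltin); rewrite Ui0 mulmx0 => /esym.
  by apply: vtx_neq0; rewrite /=; case: ifP; lia.
apply: vtx_mul_eq0 => j /= jn; have -> : vtx n.-1 j = w (n - j).+1.
  by rewrite wlo; [congr vtx|]; lia.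
rewrite -wU; last by lia.
by apply: mulmx_f_comm; rewrite wU // whi ?vtx_out //=; lia.
Qed.

Lemma horner_mx_fD n : (4 <= n)%N ->
  let A := adjacency (TypeD n) in
  horner_mx A (f (2 * n - 3)%N) = 0 /\
  forall i, (i < 2 * n - 3)%N -> horner_mx A (f i) <> 0.
Proof.
move=> n_ge4 A.
(* The walk descends from [n] to 3, splits into the sum of vertices 1 and 2 at [k] = n - 1, is back
   at 3 for [k] = [n], and leaves past [n] at [k] = 2n - 2. *)
pose w k := if (k <= n - 2)%N then vtx n.-1 (n.+1 - k)%N else
  if k == n.-1 then vtx n.-1 1 + vtx n.-1 2 else vtx n.-1 (k + 3 - n)%N.
have wlo k : (k <= n - 2)%N -> w k = vtx n.-1 (n.+1 - k)%N by rewrite /w => ->.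
have wmid k : k.+1 = n -> w k = vtx n.-1 1 + vtx n.-1 2.
  by move=> kn; rewrite /w -kn eqxx; case: ifP => // ?; lia.
have whi k : (n <= k)%N -> w k = vtx n.-1 (k + 3 - n)%N.
  by move=> lenk; rewrite /w; case: ifP => [?|_]; [lia|case: eqP => // ?; lia].
have wU k : (k <= 2 * n - 3)%N -> w 1%N *m horner_mx A (f k) = w k.+1.
  apply: (mulmx_f_rec (w := w)) => [|{}k ltkn].
    by rewrite wlo // vtx_out //=; lia.
  have [lekn|[eqkn|[eqkn|[eqkn|lenk]]]] : ((k.+2 <= n - 2) \/ (k.+3 = n) \/
    (k.+2 = n) \/ (k.+1 = n) \/ (n <= k))%N by lia.
  - rewrite !wlo; try lia.
    have [-> -> ->] : [/\ n.+1 - k = (n - k).+1, n.+1 - k.+1 = n - k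
                       & n.+1 - k.+2 = (n - k).-1]%N by split; lia.
    by rewrite vtx_adjacencyD ?addrK //; lia.
  - rewrite (wmid k.+2) ?wlo; try lia.
    have [-> ->] : (n.+1 - k = 4 /\ n.+1 - k.+1 = 3)%N by lia.
    by rewrite vtx_adjacencyD3 ?addrK //; lia.
  (* Both short legs map to vertex 3, so the step is 2 [vtx 3] - [vtx 3]: this is the reflection. *)
  - rewrite (whi k.+2) ?(wmid k.+1) ?wlo; try lia.
    have [-> ->] : (n.+1 - k = 3 /\ k.+2 + 3 - n = 3)%N by lia.
    by rewrite mulmxDl !vtx_adjacencyD1 ?addrK //; lia.
  - rewrite (wmid k) ?whi; try lia.
    have [-> ->] : (k.+1 + 3 - n = 3 /\ k.+2 + 3 - n = 4)%N by lia.
    by rewrite vtx_adjacencyD3 1?addrC ?addKr //; lia.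
  rewrite !whi; try lia.
  have [-> ->] : ((k + 3 - n = (k.+1 + 3 - n).-1) /\
                  (k.+2 + 3 - n = (k.+1 + 3 - n).+1))%N by split; lia.
  by rewrite vtx_adjacencyD 1?addrC ?addKr //; lia.
split=> [|i ltin Ui0]; last first.
  have := wU i (ltnW ltin); rewrite Ui0 mulmx0 => /esym.
  have [lei|[eqi|gti]] : ((i.+1 <= n - 2) \/ (i.+2 = n) \/ (n <= i.+1))%N by lia.
  - by rewrite wlo //; apply: vtx_neq0; rewrite /=; lia.
  - by rewrite wmid // => /rowP/(_ 0); rewrite !mxE.
  - by rewrite whi //; apply: vtx_neq0; rewrite /=; lia.
have killw k : (0 < k <= 2 * n - 2)%N ->
    w k *m horner_mx A (f (2 * n - 3)%N) = 0.
  move=> kn; have -> : k = k.-1.+1 by lia.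
  rewrite -wU; last by lia.
  apply: mulmx_f_comm; rewrite wU // whi ?vtx_out //=; lia.
(* [A] kills the antisymmetric vector, so the recursion becomes a_(k+2) = - a_k, with coefficients
   0, 1, 0, -1 of period 4. *)
pose a k : 'rV[int]_(n.-1.+1) :=
  [:: 0; 1; 0; -1]`_(k %% 4) *: (vtx n.-1 1 - vtx n.-1 2).
have aU k : a 1%N *m horner_mx A (f k) = a k.+1.
  apply: (mulmx_f_rec (w := a) (K := k)) => // [|{}k _]; first exact: scale0r.
  have vA : (vtx n.-1 1 - vtx n.-1 2) *m A = 0.
    by rewrite mulmxBl !vtx_adjacencyD1 ?subrr //; lia.
  rewrite /a -scalemxAl vA scaler0 sub0r -scaleNr; congr (_ *: _).
  rewrite -[k.+2]addn2 -modnDml; have := ltn_pmod k (isT : 0 < 4)%N.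
  by move: (k %% 4)%N => -[|[|[|[|]]]].
have killa : (vtx n.-1 1 - vtx n.-1 2) *m horner_mx A (f (2 * n - 3)%N) = 0.
  have <- : a 1%N = vtx n.-1 1 - vtx n.-1 2 by rewrite /a scale1r.
  (* The index 2n - 2 is even, so its coefficient is 0. *)
  rewrite aU /a; have := ltn_pmod (2 * n - 3).+1 (isT : 0 < 4)%N.
  by case E: ((2 * n - 3).+1 %% 4)%N => [|[|[|[|]]]] //= _;
    rewrite ?scale0r //; lia.
have kills : (vtx n.-1 1 + vtx n.-1 2) *m horner_mx A (f (2 * n - 3)%N) = 0.
  by rewrite -(wmid n.-1) ?killw //; lia.
apply: vtx_mul_eq0 => j /= jn.
have [j_ge3|j_lt3] := leqP 3 j.
  have -> : vtx n.-1 j = w (n.+1 - j)%N by rewrite wlo; [congr vtx|]; lia.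
  by apply: killw; lia.
(* The sum and the difference span only a sublattice of index 2; since the integers have no
   2-torsion, each of the two vectors is killed as well. *)
move: killa kills; rewrite mulmxBl mulmxDl => /rowP killa /rowP kills.
apply/rowP=> i; move: (killa i) (kills i).
have [->|->] : j = 1%N \/ j = 2%N by lia.
all: move: (vtx _ 1 *m _) (vtx _ 2 *m _) => u v; rewrite !mxE.
all: by move: (u _ _) (v _ _) => x y; lia.
Qed.

(** * The exceptional diagrams by computation *)

Definition seq_mul (d : diagram) (v : seq int) : seq int :=
  mkseq (fun j => foldr (fun i x => v`_i * (nedges d i.+1 j.+1)%:Z + x) 0
                    (iota 0 (nvertices d))) (nvertices d).

Definition seq_vtx (d : diagram) (i : nat) : seq int :=
  mkseq (fun j => ((j == i) : nat)%:Z) (nvertices d).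

(* The pair (row i of f_(k-1)(A), row i of f_k(A)), as coefficient lists. *)
Definition seq_f (d : diagram) (i k : nat) : seq int * seq int :=
  iter k (fun p => (p.2, mkseq (fun j => (seq_mul d p.2)`_j - p.1`_j)
                           (nvertices d)))
    ([::], seq_vtx d i).

Lemma ltn_nvertices d (j : 'I_(nvertices d).-1.+1) :
  admissible d -> (j < nvertices d)%N.
Proof. by move=> hd; rewrite -[ltnRHS](nvertices_pred hd). Qed.

(** Lists replace matrices because [vm_compute] can evaluate them. The [foldr] in [seq_mul] is what
    the big sum unlocks to. *)
Lemma row_seq_mul d (v : seq int) : admissible d ->
  \row_(j < (nvertices d).-1.+1) (seq_mul d v)`_j =
  (\row_j v`_j) *m adjacency d.
Proof.
move=> hd; apply/rowP=> j; rewrite !mxE nth_mkseq ?ltn_nvertices //.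
under eq_bigr do rewrite !mxE.
move: (nat_of_ord j) => {}j.
rewrite -(big_mkord xpredT (fun i => v`_i * (nedges d i.+1 j.+1)%:Z)).
by rewrite unlock /index_iota subn0 nvertices_pred.
Qed.

Lemma vtx_mul_seq_f d i k : admissible d ->
  vtx (nvertices d).-1 i.+1 *m horner_mx (adjacency d) (f k) =
  \row_j (seq_f d i k).2`_j.
Proof.
move=> hd; pose w k : 'rV_((nvertices d).-1.+1) := \row_j (seq_f d i k).1`_j.
have -> : vtx (nvertices d).-1 i.+1 = w 1%N.
  apply/rowP=> j; rewrite !mxE /=.
  by rewrite nth_mkseq ?ltn_nvertices // eqSS.
rewrite (mulmx_f_rec (w := w) (K := k)) => // [|{}k _].
  (* The initial empty list reads as the zero row, by the default value 0. *)
  by apply/rowP=> j; rewrite !mxE nth_nil.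
rewrite /w -row_seq_mul //; apply/rowP=> j; rewrite !mxE /=.
by rewrite nth_mkseq ?ltn_nvertices.
Qed.

(** Vanishing is tested on all rows, whereas one nonzero entry in row 0 suffices for each smaller
    index. Here [h] stands for the Coxeter number minus 1. *)
Lemma horner_mx_f_compute d h : admissible d ->
    all (fun i => all (fun x => x == 0) (seq_f d i h).2)
      (iota 0 (nvertices d)) ->
    all (fun k => has (fun x => x != 0) (seq_f d 0 k).2) (iota 0 h) ->
  horner_mx (adjacency d) (f h) = 0 /\
  forall i, (i < h)%N -> horner_mx (adjacency d) (f i) <> 0.
Proof.
move=> hd /allP Uh0 /allP Uk.
have size_f i k : size (seq_f d i k).2 = nvertices d.
  by case: k => [|k]; rewrite /= size_mkseq.
split=> [|k ltkh Uk0].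
  apply: vtx_mul_eq0 => -[//|i] /andP[_ ltin]; rewrite nvertices_pred // in ltin.
  rewrite vtx_mul_seq_f //; apply/rowP=> j; rewrite !mxE.
  have /Uh0/allP/(_ _ (mem_nth 0 _))-/(_ j) : i \in iota 0 (nvertices d).
    by rewrite mem_iota.
  by rewrite size_f ltn_nvertices // => /(_ isT)/eqP.
have /Uk/hasP[x /(nthP 0)[j]] : k \in iota 0 h by rewrite mem_iota.
rewrite size_f => ltj <- /eqP; apply.
have := vtx_mul_seq_f 0 k hd; rewrite Uk0 mulmx0.
by move/rowP/(_ (inord j)); rewrite !mxE inordK ?nvertices_pred.
Qed.

Lemma horner_mx_fE6 (h := (coxeter_number TypeE6).-1) :
  horner_mx (adjacency TypeE6) (f h) = 0 /\
  forall i, (i < h)%N -> horner_mx (adjacency TypeE6) (f i) <> 0.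
Proof. by apply: horner_mx_f_compute; vm_compute. Qed.

Lemma horner_mx_fE7 (h := (coxeter_number TypeE7).-1) :
  horner_mx (adjacency TypeE7) (f h) = 0 /\
  forall i, (i < h)%N -> horner_mx (adjacency TypeE7) (f i) <> 0.
Proof. by apply: horner_mx_f_compute; vm_compute. Qed.

Lemma horner_mx_fE8 (h := (coxeter_number TypeE8).-1) :
  horner_mx (adjacency TypeE8) (f h) = 0 /\
  forall i, (i < h)%N -> horner_mx (adjacency TypeE8) (f i) <> 0.
Proof. by apply: horner_mx_f_compute; vm_compute. Qed.

Theorem theorem3p29 (d : diagram) (hd : admissible d) (k : nat) :
  horner_mx (adjacency d) (f k) = 0 <->
  exists r : nat, (1 <= r)%N /\ k = (r * coxeter_number d - 1)%N.
Proof.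
have h_gt0 : (0 < coxeter_number d)%N by case: d hd => //= n; lia.
have [] : horner_mx (adjacency d) (f (coxeter_number d).-1) = 0 /\
    forall i, (i < (coxeter_number d).-1)%N -> horner_mx (adjacency d) (f i) <> 0.
  case: d hd {h_gt0} => [n|n||||n] hd.
  - have -> : (coxeter_number (TypeA n)).-1 = n by rewrite /= addn1.
    exact: horner_mx_fA.
  - have -> : (coxeter_number (TypeD n)).-1 = (2 * n - 3)%N by rewrite /=; lia.
    exact: horner_mx_fD.
  - exact: horner_mx_fE6.
  - exact: horner_mx_fE7.
  - exact: horner_mx_fE8.
  - have -> : (coxeter_number (TypeL n)).-1 = (2 * n)%N by rewrite /= addn1.
    exact: horner_mx_fL.
exact: horner_mx_f_eq0.
Qed.
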